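(* Let $X$ be a metrizable compact space and let $K$ be the Cantor set. Then $X$ is a dense amalgam (of some finite family of compact metrizable spaces) if and only if there are a topologically quasiconvex map $\pi: X \rightarrow K$ and a countable subset $P = P_{1}\dot{\cup}\cdots\dot{\cup}P_{n}$ of $K$ (disjoint union, $n\geq 1$) such that: \begin{itemize} \item for every $i \in \{1,\dots,n\}$, $P_{i}$ is dense in $K$; \item for every $p \in K\setminus P$, $\#\pi^{-1}(p) = 1$; \item for every $p \in P$, $X\setminus\pi^{-1}(p)$ is dense in $X$; \item for every $i$ and all $p,q \in P_{i}$, $\pi^{-1}(p)$ and $\pi^{-1}(q)$ are homeomorphic. \end{itemize} Moreover, the family $\mathcal{Y}=\mathcal Y_1\dot\cup\cdots\dot\cup\mathcal Y_n$ of the dense amalgam is given by $\mathcal{Y}_{i} = \{\pi^{-1}(p): p \in P_{i}\}$.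
   Context: A compact Hausdorff space has a unique compatible uniform structure; for an entourage $u$, a subset $A$ is $u$-small if $A\times A\subseteq u$. A quotient map $f:X\to Y$ of compact Hausdorff spaces is topologically quasiconvex if for every entourage $u$ of $X$ only finitely many fibers $f^{-1}(y)$ are not $u$-small. Dense amalgam: let $C_1,\dots,C_n$ be compact metrizable spaces. A metrizable compact space $X$ is the dense amalgam of $C_1,\dots,C_n$ if there is a family $\mathcal Y=\mathcal Y_1\dot\cup\cdots\dot\cup\mathcal Y_n$ of pairwise disjoint subsets of $X$ such that: (1) for every $i$, $\mathcal Y_i$ is countably infinite and each $C\in\mathcal Y_i$ is homeomorphic to $C_i$; (2) for every entourage $u$ of $X$, the set $\{C\in\mathcal Y: C\text{ is not }u\text{-small}\}$ is finite; (3) for every $C\in\mathcal Y$, $X\setminus C$ is dense in $X$; (4) for every $i$, $\bigcup\mathcal Y_i$ is dense in $X$; (5) if $x,y\in X$ are such that no $C\in\mathcal Y$ contains both $x$ and $y$, then there is a clopen set $F\subseteq X$ with $x\in F$, $y\notin F$ and, for every $C\in\mathcal Y$, $C\subseteq F$ or $C\cap F=\emptyset$. (Such a space exists and is unique up to homeomorphism.)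
   Formalization: Condition (5) of the dense amalgam is required only for distinct points x and y; taken literally with x = y it would fail at any point lying in no member of the family, so that no dense amalgam would exist. *)

(* Defs.v *)
From HB Require Import structures.
From mathcomp Require Import all_boot all_order all_algebra.
From mathcomp Require Import all_classical all_reals all_analysis.

Set Implicit Arguments.
Unset Strict Implicit.
Unset Printing Implicit Defensive.

Local Open Scope classical_set_scope.
Local Open Scope card_scope.

Definition homeomorphic (S T : topologicalType) : Prop :=
  exists (f : S -> T) (g : T -> S),
    [/\ cancel f g, cancel g f, continuous f & continuous g].

Definition metrizable (R : realType) (T : topologicalType) : Prop :=
  exists M : metricType R, homeomorphic T M.

Definition quotient_map (S T : topologicalType) (f : S -> T) : Prop :=
  set_surj [set: S] [set: T] f /\
  forall V : set T, open V <-> open (f @^-1` V).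

Definition small (X : Type) (u : set (X * X)) (A : set X) : Prop :=
  A `*` A `<=` u.

Definition fiber (S T : Type) (f : S -> T) (t : T) : set S := f @^-1` [set t].

(* Meant for X compact Hausdorff: the uniform structure carried by X is then
   the only one that induces its topology. *)
Definition topologically_quasiconvex (X : uniformType) (T : topologicalType)
    (f : X -> T) : Prop :=
  quotient_map f /\
  forall u : set (X * X), entourage u ->
    finite_set [set A | range (fiber f) A /\ ~ small u A].

(* The library equips [set_type A] with the subspace topology.
   The points x and y of [amalgam_separation] must be distinct: a point
   outside every member of the family cannot be separated from itself. *)
Record dense_amalgam_family (X : uniformType) (n : nat)
    (C : 'I_n -> topologicalType) (Y : 'I_n -> set (set X)) : Prop := {
  amalgam_disjoint_subfamilies : trivIset [set: 'I_n] Y;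
  amalgam_disjoint_members : trivIset (\bigcup_i Y i) id;
  amalgam_countably_infinite : forall i, Y i #= [set: nat];
  amalgam_homeomorphic : forall i (A : set X), Y i A ->
    homeomorphic (set_type A) (C i);
  amalgam_null : forall u : set (X * X), entourage u ->
    finite_set [set A | (\bigcup_i Y i) A /\ ~ small u A];
  amalgam_codense : forall A : set X, (\bigcup_i Y i) A -> dense (~` A);
  amalgam_dense : forall i, dense (\bigcup_(A in Y i) A);
  amalgam_separation : forall x y : X, x <> y ->
    ~ (exists A : set X, [/\ (\bigcup_i Y i) A, A x & A y]) ->
    exists F : set X, [/\ clopen F, F x, ~ F y &
      forall A : set X, (\bigcup_i Y i) A -> A `<=` F \/ A `&` F = set0]
}.

Definition dense_amalgam (X : uniformType) (n : nat)
    (C : 'I_n -> topologicalType) : Prop :=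
  exists Y : 'I_n -> set (set X), dense_amalgam_family C Y.

Record amalgam_projection (X : uniformType) (n : nat)
    (pi : X -> cantor_space) (P : 'I_n -> set cantor_space) : Prop := {
  projection_quasiconvex : topologically_quasiconvex pi;
  projection_countable : countable (\bigcup_i P i);
  projection_disjoint : trivIset [set: 'I_n] P;
  projection_dense : forall i, dense (P i);
  projection_singleton : forall p, ~ (\bigcup_i P i) p -> fiber pi p #= `I_1;
  projection_codense : forall p, (\bigcup_i P i) p -> dense (~` fiber pi p);
  projection_homeomorphic : forall i p q, P i p -> P i q ->
    homeomorphic (set_type (fiber pi p)) (set_type (fiber pi q))
}.

(* Main.v *)
(* From an amalgam to a projection, collapse each member of the family to a point.
   Condition (5) makes the quotient Hausdorff and zero-dimensional; it has no
   isolated point, since the union of each subfamily is dense while each member has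
   dense complement. A compact metrizable X has only countably many clopen sets, so
   the quotient embeds into the Cantor space, and Brouwer's characterization
   identifies it with the Cantor space.

   Conversely, the only delicate point is that the fibers over P_i fill a dense set.
   By quasiconvexity all but finitely many fibers are small, and finitely many closed
   sets with dense complement do not cover an open set; so every nonempty open set
   contains a whole small fiber, hence by compactness all fibers over nearby points,
   and P_i is dense. *)
Require Import Defs.
From HB Require Import structures.
From mathcomp Require Import all_boot all_order all_algebra.
From mathcomp Require Import all_classical all_reals all_analysis.

Set Implicit Arguments.
Unset Strict Implicit.
Unset Printing Implicit Defensive.

Local Open Scope classical_set_scope.
Local Open Scope card_scope.

(** * Homeomorphisms, subspaces and hereditary properties *)

Lemma homeomorphic_sym (S T : topologicalType) :
  homeomorphic S T -> homeomorphic T S.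
Proof. by move=> [f [g [fK gK cf cg]]]; exists g, f. Qed.

Lemma homeomorphic_trans (S T U : topologicalType) :
  homeomorphic S T -> homeomorphic T U -> homeomorphic S U.
Proof.
move=> [f [g [fK gK cf cg]]] [h [k [hK kK ch ck]]].
exists (h \o f), (g \o k); split; [exact: can_comp|exact: can_comp| |].
- by move=> x; apply: continuous_comp; [exact: cf|exact: ch].
- by move=> x; apply: continuous_comp; [exact: ck|exact: cg].
Qed.

(** An alias of [set_type A] on which the restricted distance is declared. The pseudometric is
    copied from [set_type A], so the topology is the subspace topology by conversion. *)
Definition sub_metric (R : realType) (M : metricType R) (A : set M) : Type :=
  set_type A.

Section sub_metric.
Variables (R : realType) (M : metricType R) (A : set M).

HB.instance Definition _ := PseudoMetric.copy (sub_metric A) (set_type A).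

Let dist (x y : sub_metric A) : R := mdist (val x) (val y).

Let dist_ge0 x y : (0 <= dist x y)%R.
Proof. exact: mdist_ge0. Qed.

Let dist_positivity x y : dist x y = 0%R -> x = y.
Proof. by move=> /mdist_positivity /val_inj. Qed.

Let ballEdist x d : ball x d = [set y | (dist x y < d)%R].
Proof. by rewrite -[ball x d]initial_ballE ballEmdist. Qed.

HB.instance Definition _ := @PseudoMetric_isMetric.Build R (sub_metric A)
  dist dist_ge0 dist_positivity ballEdist.

End sub_metric.

Lemma set_type_continuous (S T : topologicalType) (B : set T)
    (f : S -> set_type B) : continuous (set_val \o f) -> continuous f.
Proof. exact: (@continuous_comp_initial (set_type B) S T set_val f). Qed.

Lemma set_val_continuous (T : topologicalType) (A : set T) :
  continuous (set_val : set_type A -> T).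
Proof. exact: initial_continuous. Qed.

Lemma homeomorphic_set_type (S T : topologicalType) (f : S -> T) (g : T -> S)
    (A : set S) : cancel f g -> cancel g f -> continuous f -> continuous g ->
  homeomorphic (set_type A) (set_type (g @^-1` A)).
Proof.
move=> fK gK cf cg.
have fA (x : set_type A) : f (set_val x) \in g @^-1` A.
  by rewrite inE /= fK; exact: (set_valP x).
have gA (y : set_type (g @^-1` A)) : g (set_val y) \in A.
  by rewrite inE; exact: (set_valP y).
exists (fun x => SigSub (fA x)), (fun y => SigSub (gA y)); split.
- by move=> x; apply: val_inj => /=; rewrite -[RHS]fK.
- by move=> y; apply: val_inj => /=; rewrite -[RHS]gK.
- apply: set_type_continuous => x; apply: (@continuous_comp _ _ _ set_val f); last exact: cf.
  exact: set_val_continuous.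
- apply: set_type_continuous => y; apply: (@continuous_comp _ _ _ set_val g); last exact: cg.
  exact: set_val_continuous.
Qed.

Lemma metrizable_set_type (R : realType) (T : topologicalType) (A : set T) :
  metrizable R T -> metrizable R (set_type A).
Proof.
move=> [M [f [g [fK gK cf cg]]]].
by exists (sub_metric (g @^-1` A)); exact: homeomorphic_set_type fK gK cf cg.
Qed.

Lemma injective_hausdorff (S T : topologicalType) (f : S -> T) :
  injective f -> continuous f -> hausdorff_space T -> hausdorff_space S.
Proof.
move=> injf cf hT x y clxy; apply/injf/hT => U V /cf fU /cf fV.
by have [z []] := clxy _ _ fU fV; exists (f z).
Qed.

Lemma injective_zero_dimensional (S T : topologicalType) (f : S -> T) :
  injective f -> continuous f -> zero_dimensional T -> zero_dimensional S.
Proof.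
move=> injf cf zT x y xy.
have /zT[U [cU Ufx Ufy]] : f x != f y by apply: contra_neq xy; exact: injf.
by exists (f @^-1` U); split=> //; exact: preimage_clopen.
Qed.

Lemma metrizable_hausdorff (R : realType) (T : topologicalType) :
  metrizable R T -> hausdorff_space T.
Proof.
move=> [M [f [g [fK _ cf _]]]].
exact: (injective_hausdorff (can_inj fK) cf (@metric_hausdorff R M)).
Qed.

Lemma compact_set_type (T : topologicalType) (A : set T) :
  compact A -> compact [set: set_type A].
Proof.
move=> cA F FF _.
have FA : F (set_val @^-1` A).
  by apply: (@filterS _ F _ setT) => [x _|]; [exact: (set_valP x)|exact: filterT].
(* The filter is pushed forward along the inclusion; a cluster point in [A] of the image filter
   lifts to one of [F]. *)
have [x [Ax clx]] := cA (@set_val T A @ F) _ FA.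
exists (SigSub (mem_set Ax)); split=> // U V FU [_ [[W oW <-] Wx WV]].
have FU' : F (set_val @^-1` [set set_val u | u in U]).
  by apply: (@filterS _ F _ U) => // u Uu; exists u.
have [_ [[u Uu <-] Wu]] := clx _ _ FU' (open_nbhs_nbhs (conj oW Wx)).
by exists u; split=> //; exact: WV. Qed.

(** * Continuous maps from compact to Hausdorff spaces *)

Lemma continuous_closed_map (S T : topologicalType) (f : S -> T) (A : set S) :
  compact [set: S] -> hausdorff_space T -> continuous f ->
  closed A -> closed (f @` A).
Proof.
move=> cS hT cf clA; apply: (compact_closed hT).
apply: continuous_compact; first exact: continuous_subspaceT.
exact: subclosed_compact clA cS _.
Qed.

Lemma compact_quotient_map (S T : topologicalType) (f : S -> T) :
  compact [set: S] -> hausdorff_space T -> continuous f ->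
  set_surj [set: S] [set: T] f -> quotient_map f.
Proof.
move=> cS hT cf sf; split=> // V; split=> [|oV]; first by apply/continuousP: V.
rewrite -closedC.
have -> : ~` V = f @` (~` (f @^-1` V)).
  apply/seteqP; split=> [y Vy|_ [x Vx <-] //].
  by have [x _ fx] := sf y I; exists x => //=; rewrite fx.
by apply: continuous_closed_map => //; exact: open_closedC.
Qed.

(** Since [f] is a closed map, the points whose fibers avoid the complement of [U] form an open
    set. *)
Lemma compact_tube (S T : topologicalType) (f : S -> T) (U : set S) (y : T) :
  compact [set: S] -> hausdorff_space T -> continuous f ->
  open U -> fiber f y `<=` U ->
  exists V : set T, [/\ open V, V y & f @^-1` V `<=` U].
Proof.
move=> cS hT cf oU fU; exists (~` (f @` ~` U)); split.
- rewrite openC; apply: continuous_closed_map => //; exact: open_closedC.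
- by move=> [x Ux fx]; exact/Ux/fU.
- by move=> x fx; apply: contrapT => Ux; apply: fx; exists x.
Qed.

(** * Density, small sets and cardinality *)

Lemma open_dense_bigcap (T : topologicalType) (I : choiceType) (A : set I)
    (F : I -> set T) : finite_set A ->
  (forall i, A i -> open (F i) /\ dense (F i)) ->
  dense (\bigcap_(i in A) F i).
Proof.
move=> finA odF.
(* Openness is carried through the induction, because two dense sets are only sure to have dense
   intersection when one of them is open. *)
suff [] : open (\bigcap_(i in A) F i) /\ dense (\bigcap_(i in A) F i) by [].
rewrite -bigsetI_fset_set// big_seq.
apply: (big_ind (fun U => open U /\ dense U)).
- by split; [exact: openT|move=> O O0 _; rewrite setIT].
- by move=> U V [oU dU] [oV dV]; split; [exact: openI|exact: denseI].
- by move=> i; rewrite in_fset_set// inE; exact: odF.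
Qed.

Lemma small_set1 (X : uniformType) (u : set (X * X)) (x : X) :
  entourage u -> small u [set x].
Proof. by move=> eu [y z] [/= -> ->]; exact: entourage_refl. Qed.

Lemma card_eq1 (T : Type) (A : set T) :
  A #= `I_1 -> exists x, A = [set x].
Proof.
move=> /eq_cardSP[x Ax]; rewrite II0 card_eq0 => /eqP AD; exists x.
by rewrite -(setD1K Ax) AD setU0.
Qed.

(** A finite dense set would be closed, hence the whole space; singletons would then have finite, so
    closed, complements and be isolated points. *)
Lemma dense_perfect_infinite (T : topologicalType) (A : set T) :
  [set: T] !=set0 -> hausdorff_space T -> perfect_set [set: T] -> dense A ->
  infinite_set A.
Proof.
move=> [t _] hT /perfectTP pT dA finA.
have clF := accessible_finite_set_closed.1 (hausdorff_accessible hT).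
have AT : ~` A = set0.
  apply: contrapT => /eqP/set0P nA.
  by have [|y []] := dA (~` A) nA; [rewrite openC; exact: clF|].
apply: (pT t); rewrite -closedC; apply: clF; apply: sub_finite_set finA.
by rewrite -[A]setCK AT setC0.
Qed.

Lemma eq_card_nat_countable_infinite (T : Type) (A : set T) :
  A #= [set: nat] <-> countable A /\ infinite_set A.
Proof. by rewrite infiniteP; exact: card_eqPle. Qed.

(** * From a projection onto the Cantor space to a dense amalgam *)

Section projection_to_amalgam.
Variables (R : realType) (X : uniformType) (n : nat).
Variables (pi : X -> cantor_space) (P : 'I_n -> set cantor_space).
Hypothesis compactX : compact [set: X].
Hypothesis projP : amalgam_projection pi P.

Let quot_pi : quotient_map pi := (projection_quasiconvex projP).1.

Let continuous_pi : continuous pi.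
Proof. by apply/continuousP => V /(quot_pi.2 V). Qed.

Let fiber_nonempty p : fiber pi p !=set0.
Proof. by have [x _ <-] := quot_pi.1 p I; exists x. Qed.

Let fiber_inj : injective (fiber pi).
Proof.
by move=> p q pq; have [x xp] := fiber_nonempty p; rewrite -xp; move: xp; rewrite pq.
Qed.

Lemma closed_fiber p : closed (fiber pi p).
Proof.
apply: preimage_closed => //; apply: accessible_closed_set1.
exact: (hausdorff_accessible cantor_space_hausdorff).
Qed.

Lemma bigcup_fiber_image : \bigcup_i [set fiber pi p | p in P i] =
  [set fiber pi p | p in \bigcup_i P i].
Proof. by rewrite image_bigcup. Qed.

Lemma dense_bigcup_fiber i : dense (\bigcup_(A in [set fiber pi p | p in P i]) A).
Proof.
move=> U [x Ux] oU.
have [E entE EU] : exists2 E, entourage E & xsection E x `<=` U.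
  by have := open_nbhs_nbhs (conj oU Ux); rewrite -nbhs_entourageE => -[E ? ?]; exists E.
(* Half of [E]: one step goes from [x] to a nearby [y], a second one runs inside the fiber of [y],
   and the two together stay in [U]. *)
pose v := split_ent E; have entv : entourage v := entourage_split_ent entE.
pose bad := [set A | range (fiber pi) A /\ ~ small v A].
have dD : dense (\bigcap_(A in bad) ~` A).
  apply: open_dense_bigcap => [|_ [[p _ <-] nsmall]].
    exact: (projection_quasiconvex projP).2.
  split; first by rewrite openC; exact: closed_fiber.
  (* A point outside the union of the [P i] has a singleton fiber, which is small; so every bad
     fiber lies over that union. *)
  apply: (projection_codense projP); apply: contrapT => Pp; apply: nsmall.
  by have [y ->] := card_eq1 (projection_singleton projP Pp); exact: small_set1.
(* The interior is taken because the section is a neighbourhood of [x] that need not be open. *)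
have [y [yv yD]] : (xsection v x)^° `&` \bigcap_(A in bad) ~` A !=set0.
  apply: dD; last exact: open_interior.
  by exists x; apply: nbhs_entourage.
have smally : small v (fiber pi (pi y)).
  by apply: contrapT => nsmall; apply: (yD (fiber pi (pi y))) => //; split.
have [V [oV Vy VU]] : exists V, [/\ open V, V (pi y) & pi @^-1` V `<=` U].
  apply: compact_tube => // [|z zy]; first exact: cantor_space_hausdorff.
  apply/EU/xsectionP/(entourage_split y) => //; last exact: (smally (y, z)).
  by apply/xsectionP; exact: interior_subset.
have [p [Vp Pp]] : V `&` P i !=set0.
  by apply: (projection_dense projP) => //; exists (pi y).
have [z zp] := fiber_nonempty p; exists z; split.
  by apply: VU; rewrite /= zp.
by exists (fiber pi p) => //; exists p.
Qed.

Lemma projection_amalgam : metrizable R X ->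
  exists C : 'I_n -> topologicalType,
    (forall i, compact [set: C i] /\ metrizable R (C i)) /\
    dense_amalgam_family C (fun i => [set fiber pi p | p in P i]).
Proof.
move=> metrizableX.
have Pnonempty i : exists p, P i p.
  have [|p [_ Pp]] := projection_dense projP i _ (@openT cantor_space).
    by exists point.
  by exists p.
have [c cP] := choice Pnonempty.
(* The model of the [i]-th subfamily is the fiber over an arbitrarily chosen point of [P i]. *)
exists (fun i => set_type (fiber pi (c i))); split=> [i|].
  split; last exact: metrizable_set_type.
  apply: compact_set_type; apply: subclosed_compact compactX _ => //.
  exact: closed_fiber.
split.
- move=> i j _ _ [_ [[p Pip <-] [q Pjq /fiber_inj qp]]].
  by apply: (projection_disjoint projP) => //; exists p; split=> //; rewrite -qp.
- rewrite bigcup_fiber_image => _ _ [p _ <-] [q _ <-] [x [xp xq]].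
  by rewrite -xp -xq.
- move=> i; have Pi : [set fiber pi p | p in P i] #= P i.
    by apply: inj_card_eq => p q _ _; exact: fiber_inj.
  rewrite (card_eql Pi); apply/eq_card_nat_countable_infinite; split.
    apply: sub_countable (projection_countable projP).
    by apply: subset_card_le; exact: bigcup_sup.
  apply: (dense_perfect_infinite _ cantor_space_hausdorff cantor_perfect).
    by exists point.
  exact: (projection_dense projP).
- by move=> i _ [p Pp <-]; exact: (projection_homeomorphic projP Pp (cP i)).
- move=> u entu; apply: sub_finite_set ((projection_quasiconvex projP).2 u entu).
  by rewrite bigcup_fiber_image => _ [[p _ <-] ?]; split.
- by rewrite bigcup_fiber_image => _ [p Pp <-]; exact: (projection_codense projP Pp).
- exact: dense_bigcup_fiber.
- move=> x y xy; rewrite bigcup_fiber_image => nxy.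
  (* A common image would either put both points in one member of the family or, having a singleton
     fiber, make them equal. *)
  have /eqP : pi x <> pi y.
    move=> pxy; have [Pp|Pp] := pselect ((\bigcup_i P i) (pi x)).
      by apply: nxy; exists (fiber pi (pi x)); split=> //; exists (pi x).
    have [z xz] := card_eq1 (projection_singleton projP Pp); apply: xy.
    have : fiber pi (pi x) x by [].
    have : fiber pi (pi x) y by [].
    by rewrite xz => -> ->.
  move=> /cantor_zero_dimensional[V [cV Vx Vy]].
  (* A preimage under [pi] is a union of fibers, so it contains or misses each member. *)
  exists (pi @^-1` V); split=> //; first exact: preimage_clopen.
  move=> _ [p _ <-]; have [Vp|Vp] := pselect (V p).
    by left=> z zp; rewrite /= zp.
  by right; apply/seteqP; split=> // z [zp]; rewrite /= zp.
Qed.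

End projection_to_amalgam.

(** * Clopen sets and the Cantor space *)

Lemma clopen_enumeration (R : realType) (X : topologicalType) (x0 : X) :
  compact [set: X] -> metrizable R X ->
  exists U : nat -> set X,
    (forall k, clopen (U k)) /\ forall F, clopen F -> exists k, U k = F.
Proof.
move=> cX [M [f [g [fK gK cf cg]]]].
(* [clopen_surj] is stated for pointed spaces, so [f x0] is taken as base point; the enumeration is
   then carried back to [X] along [f]. *)
pose M' : pseudoPMetricType R :=
  HB.pack (Metric.sort M) (isPointed.Build (Metric.sort M) (f x0)).
have cM : compact [set: M'].
  have -> : [set: M'] = [set f x | x in [set: X]].
    by apply/seteqP; split=> // y _; exists (g y) => //; exact: gK.
  by apply: continuous_compact => //; exact: continuous_subspaceT.
have [U] := clopen_surj cM; exists (fun k => f @^-1` (U k)); split=> [k|F cF].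
  have cUk : @clopen M' (U k) by exact: funS.
  exact: (@preimage_clopen X M f).
have [k _ Uk] : exists2 k, [set: nat] k & U k = g @^-1` F.
  by apply: surj; apply: (@preimage_clopen M X g).
by exists k; rewrite Uk; apply/seteqP; split=> x /=; rewrite fK.
Qed.

(** Brouwer's characterization yields a continuous closed bijection from the Cantor space. Its
    inverse is continuous because preimages under the inverse are images under the closed map. *)
Lemma cantor_like_homeomorphic (R : realType) (T : pseudoMetricType R) (t : T) :
  cantor_like T -> homeomorphic T cantor_space.
Proof.
move=> cT.
pose T' : pseudoPMetricType R :=
  HB.pack (PseudoMetric.sort T) (isPointed.Build (PseudoMetric.sort T) t).
have [f [cf clf]] := @homeomorphism_cantor_like R T' cT.
have fK : cancel f f^-1%FUN by move=> x; rewrite funK ?inE.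
have gK : cancel f^-1%FUN f by move=> x; rewrite invK ?inE.
exists f^-1%FUN, f; split=> //; apply/continuous_closedP => A clA.
have -> : f^-1%FUN @^-1` A = [set f x | x in A]; last exact: clf.
by apply/seteqP; split=> [y Ay|_ [x Ax <-]]; [exists (f^-1%FUN y)|rewrite /= fK].
Qed.

Lemma clopen_asbool_continuous (T : topologicalType) (A : set T) :
  clopen A -> continuous (fun x => `[< A x >]).
Proof.
move=> [oA cA]; apply/continuousP => B _.
have [Bt|Bt] := pselect (B true); have [Bf|Bf] := pselect (B false).
- by have -> : (fun x => `[< A x >]) @^-1` B = setT;
    [apply/seteqP; split=> // x _ /=; case: asboolP|exact: openT].
- by have -> : (fun x => `[< A x >]) @^-1` B = A;
    [apply/seteqP; split=> x /=; case: asboolP|].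
- have -> : (fun x => `[< A x >]) @^-1` B = ~` A; last by rewrite openC.
  by apply/seteqP; split=> x /=; case: asboolP.
- by have -> : (fun x => `[< A x >]) @^-1` B = set0;
    [apply/seteqP; split=> // x /=; case: asboolP|exact: open0].
Qed.

Lemma clopen_family_continuous (T : topologicalType) (F : nat -> set T) :
  (forall k, clopen (F k)) ->
  continuous (fun x => (fun k => `[< F k x >]) : cantor_space).
Proof.
move=> cF x; apply/cvg_sup => k.
exact: (@continuous_comp_initial _ T bool (@proj _ (fun=> bool) k) _
  (clopen_asbool_continuous (cF k)) x).
Qed.

(** * From a dense amalgam to a projection onto the Cantor space *)

Section amalgam_to_projection.
Variables (R : realType) (X : uniformType) (n : nat).
Variables (C : 'I_n -> topologicalType) (Y : 'I_n -> set (set X)).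
Hypotheses (compactX : compact [set: X]) (metrizableX : metrizable R X).
Hypotheses (n_gt0 : (0 < n)%N) (amY : dense_amalgam_family C Y).

(** The relation that collapses each member to a point; equality is added for the points outside all
    members. *)
Let related (x y : X) : Prop :=
  x = y \/ exists A, [/\ (\bigcup_i Y i) A, A x & A y].

Lemma amalgam_member_eq (A B : set X) x : (\bigcup_i Y i) A ->
  (\bigcup_i Y i) B -> A x -> B x -> A = B.
Proof.
by move=> YA YB Ax Bx; apply: (amalgam_disjoint_members amY) => //; exists x.
Qed.

(** All sets in one subfamily are homeomorphic to the same space. If one were empty, all would be,
    and the subfamily would have at most one element instead of infinitely many. *)
Lemma amalgam_member_nonempty (A : set X) : (\bigcup_i Y i) A -> A !=set0.
Proof.
move=> [i _ YA]; apply/set0P/eqP => A0.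
have noA a : ~ A a by rewrite A0.
have /eq_card_nat_countable_infinite[_] := amalgam_countably_infinite amY i.
apply; apply: (sub_finite_set _ (finite_set1 (set0 : set X))) => B YB /=.
apply: contrapT => /eqP/set0P[b Bb].
have [f [_ [_ _ _ _]]] := amalgam_homeomorphic amY YB.
have [_ [g [_ _ _ _]]] := amalgam_homeomorphic amY YA.
exact: noA (set_valP (g (f (SigSub (mem_set Bb))))).
Qed.

(* The saturated clopen sets are countably many and separate the classes, so their
   indicator functions embed the space of classes into the Cantor space. *)
Lemma amalgam_cantor_map : exists g : X -> cantor_space,
  continuous g /\ forall x y, g x = g y <-> related x y.
Proof.
have [x0 | noX] := pselect (inhabited X); last first.
  exists (fun=> point); split=> [|x]; first exact: cst_continuous.
  by case: noX; exists.
have {x0}[x0] := x0.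
have [U [cU surU]] := clopen_enumeration x0 compactX metrizableX.
pose sat (F : set X) := forall A, (\bigcup_i Y i) A -> A `<=` F \/ A `&` F = set0.
(* This is [U k] when [U k] is saturated and empty otherwise, so all coordinates are clopen and
   constant on classes. *)
pose F k := [set x | sat (U k) /\ U k x].
exists (fun x k => `[< F k x >]); split.
  apply: clopen_family_continuous => k; rewrite /F.
  have [sU|sU] := pselect (sat (U k)).
    by have -> : [set x | sat (U k) /\ U k x] = U k;
      [apply/seteqP; split=> x //= []|].
  by have -> : [set x | sat (U k) /\ U k x] = set0;
    [apply/seteqP; split=> x //= []|exact: clopen0].
move=> x y; split=> [gxy|[->//|[A [YA Ax Ay]]]].
  apply: contrapT => /not_orP[xy nxy].
  have [G [cG Gx Gy satG]] := amalgam_separation amY xy nxy.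
  have [k Uk] := surU G cG; have := congr1 (fun h : cantor_space => h k) gxy.
  rewrite /F Uk /=; have /asboolP -> : sat G /\ G x by [].
  by move=> /esym/asboolP[].
apply/funext => k; apply: asbool_equiv_eq.
have FA z w : A z -> A w -> F k z -> F k w.
  move=> Az Aw [sU Uz]; split=> //; have [|AU] := sU A YA; first exact.
  by have : (A `&` U k) z by []; rewrite AU.
by split; exact: FA.
Qed.

Lemma amalgam_quotient : exists pi : X -> cantor_space,
  [/\ continuous pi, set_surj [set: X] [set: cantor_space] pi &
      forall x y, pi x = pi y <-> related x y].
Proof.
have [g [cg gE]] := amalgam_cantor_map.
(* One subfamily suffices: it provides a point of [X], and the density of its union excludes
   isolated points below. *)
pose i0 := Ordinal n_gt0.
have [A0 YA0] : exists A, Y i0 A.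
  have /eq_card_nat_countable_infinite[_] := amalgam_countably_infinite amY i0.
  by move=> /infinite_setN0.
have [x0 _] : A0 !=set0 by apply: amalgam_member_nonempty; exists i0.
(* The range of [g] serves as the quotient space; it inherits separation and zero-dimensionality
   from the Cantor space. *)
pose g' (x : X) : set_type (range g) := SigSub (mem_set (imageT g x)).
have cg' : continuous g' by exact: set_type_continuous.
have g'E x y : g' x = g' y <-> related x y.
  rewrite -gE; split=> [/(congr1 val)//|gxy]; exact: val_inj.
have sg' z : exists x, g' x = z.
  have [x _ gx] := set_valP z; exists x; exact: val_inj.
have val_inj' : injective (set_val : set_type (range g) -> cantor_space).
  exact: val_inj.
have cval := @set_val_continuous cantor_space (range g).
have cZ : cantor_like (set_type (range g)).
  split.
  (* The class over an isolated point would be open. It would then contain a point [w] of some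
     member [A] and a point [v] outside [A], yet points of one class cannot be split by a member. *)
  - apply/perfectTP => z oz; have [x gx] := sg' z.
    have oO : open (g' @^-1` [set z]) by move/continuousP: cg'; exact.
    have [w [wz [A YA Aw]]] := amalgam_dense amY i0 (ex_intro _ x gx) oO.
    have YA' : (\bigcup_i Y i) A by exists i0.
    have [v [vz Av]] := amalgam_codense amY YA' (ex_intro _ x gx) oO.
    have /g'E[vw|[B [YB Bv Bw]]] : g' v = g' w by rewrite wz vz.
      by apply: Av; rewrite vw.
    by apply: Av; rewrite (amalgam_member_eq YA' YB Aw Bw).
  - apply: compact_set_type; apply: continuous_compact => //.
    exact: continuous_subspaceT.
  - exact: injective_hausdorff val_inj' cval cantor_space_hausdorff.
  - exact: injective_zero_dimensional val_inj' cval cantor_zero_dimensional.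
have [h [k [hK kK ch ck]]] := @cantor_like_homeomorphic R _ (g' x0) cZ.
exists (h \o g'); split=> [x|p _|x y].
- by apply: continuous_comp; [exact: cg'|exact: ch].
- by have [x gx] := sg' (k p); exists x => //=; rewrite gx kK.
- by rewrite -g'E /=; split=> [/(can_inj hK)|->].
Qed.

Lemma amalgam_projection_exists :
  exists (pi : X -> cantor_space) (P : 'I_n -> set cantor_space),
    amalgam_projection pi P /\ forall i, Y i = [set fiber pi p | p in P i].
Proof.
have [pi [cpi surpi piE]] := amalgam_quotient.
have fiberE A x : (\bigcup_i Y i) A -> A x -> fiber pi (pi x) = A.
  move=> YA Ax; apply/seteqP; split=> [y /piE[->//|[B [YB By Bx]]]|y Ay].
    by rewrite (amalgam_member_eq YA YB Ax Bx).
  by apply/piE; right; exists A.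
have fiber_inj : injective (fiber pi).
  move=> p q pq; have [x _ xp] := surpi p I; rewrite -xp.
  by have : fiber pi p x by []; rewrite pq.
(* Each member is exactly one fiber, so [fiber pi] is a bijection from [P i] to [Y i]; countability
   and disjointness transfer along it. *)
pose P i := [set p | Y i (fiber pi p)].
have YE i : Y i = [set fiber pi p | p in P i].
  apply/seteqP; split=> [A YA|_ [p Pp <-] //].
  have YA' : (\bigcup_i Y i) A by exists i.
  have [x Ax] := amalgam_member_nonempty YA'.
  by exists (pi x); rewrite /P /= (fiberE A).
have fiber1 p : ~ (\bigcup_i P i) p -> exists x, fiber pi p = [set x].
  move=> Pp; have [x _ xp] := surpi p I; exists x; rewrite -xp.
  apply/seteqP; split=> [y /piE[//|[A [YA Ay Ax]]]|_ -> //].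
  case: Pp; have [i _ YiA] := YA; exists i => //.
  by rewrite /P /= -xp (fiberE A).
exists pi, P; split=> //; split.
- split; first exact: compact_quotient_map compactX cantor_space_hausdorff cpi surpi.
  move=> u entu; apply: sub_finite_set (amalgam_null amY entu).
  (* Fibers outside the family are singletons, hence small, so only members can fail to be small. *)
  move=> _ [[p _ <-] nsmall]; split=> //; apply: contrapT => Yp; apply: nsmall.
  have [|x ->] := fiber1 p; last exact: small_set1.
  by move=> [i _ Pp]; apply: Yp; exists i.
- apply: bigcup_countable => // i _.
  have PY : [set fiber pi p | p in P i] #= P i.
    by apply: inj_card_eq => p q _ _; exact: fiber_inj.
  rewrite -(eq_countable PY) -YE.
  by have /eq_card_nat_countable_infinite[] := amalgam_countably_infinite amY i.
- move=> i j _ _ [p [Pi Pj]].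
  by apply: (amalgam_disjoint_subfamilies amY) => //; exists (fiber pi p).
- move=> i O [p Op] oO; have [x _ xp] := surpi p I.
  (* The nonempty open preimage of [O] meets a member of [Y i], and that member is collapsed to a
     point of [P i] in [O]. *)
  have [||w [Ow [A YA Aw]]] := amalgam_dense amY i (O := pi @^-1` O).
  + by exists x; rewrite /= xp.
  + by move/continuousP: cpi; exact.
  by exists (pi w); split=> //; rewrite /P /= (fiberE A) //; exists i.
- by move=> p /fiber1[x ->]; exact: card_set1.
- by move=> p [i _ Pp]; apply: (amalgam_codense amY); exists i.
- move=> i p q Pp Pq; apply: homeomorphic_trans (amalgam_homeomorphic amY Pp) _.
  exact: homeomorphic_sym (amalgam_homeomorphic amY Pq).
Qed.

End amalgam_to_projection.

(** The description of the family is split into two clauses, one for each direction of the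
    construction. *)
Theorem proposition1p21 (R : realType) (X : uniformType)
    (compactX : compact [set: X]) (metrizableX : metrizable R X) :
  [/\ (exists (n : nat) (C : 'I_n -> topologicalType),
         [/\ (0 < n)%N,
             forall i, compact [set: C i] /\ metrizable R (C i) &
             dense_amalgam X C])
      <->
      (exists (n : nat) (pi : X -> cantor_space) (P : 'I_n -> set cantor_space),
         (0 < n)%N /\ amalgam_projection pi P),
      forall (n : nat) (C : 'I_n -> topologicalType) (Y : 'I_n -> set (set X)),
        (0 < n)%N ->
        (forall i, compact [set: C i] /\ metrizable R (C i)) ->
        dense_amalgam_family C Y ->
        exists (pi : X -> cantor_space) (P : 'I_n -> set cantor_space),
          amalgam_projection pi P /\
          forall i, Y i = [set fiber pi p | p in P i]
    & forall (n : nat) (pi : X -> cantor_space) (P : 'I_n -> set cantor_space),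
        (0 < n)%N ->
        amalgam_projection pi P ->
        exists C : 'I_n -> topologicalType,
          (forall i, compact [set: C i] /\ metrizable R (C i)) /\
          dense_amalgam_family C (fun i => [set fiber pi p | p in P i])].
Proof.
split.
- split=> [[n [C [n0 _ [Y amY]]]]|[n [pi [P [n0 projP]]]]].
    have [pi [P [projP _]]] :=
      amalgam_projection_exists compactX metrizableX n0 amY.
    by exists n, pi, P.
  have [C [mC amP]] := projection_amalgam compactX projP metrizableX.
  by exists n, C; split=> //; exists (fun i => [set fiber pi p | p in P i]).
- move=> n C Y n0 _ amY.
  exact: amalgam_projection_exists compactX metrizableX n0 amY.
- by move=> n pi P _ projP; exact: projection_amalgam compactX projP metrizableX.
Qed.
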